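(* Let $n\ge 1$ and let $\gamma_n=\gamma_n(z)$, $z>0$, be the recurrence coefficient of the monic truncated Hermite polynomials $P_n(x;z)$, with $'$ denoting the derivative with respect to $z$. Then $\gamma_n$ satisfies $$z^{2}\left[\gamma_{n}''+2\left(6\gamma_{n}-n\right)\left(2\gamma_{n}-n\right)\right]^{2}=4\left(z^{2}+2\gamma_{n}-n\right)^{2}\left[\left(\gamma_{n}'\right)^{2}+4\gamma_{n}\left(2\gamma_{n}-n\right)^{2}\right].$$
   Context: For $z>0$ let $L[p]=\int_{-z}^{z}p(x)e^{-x^{2}}dx$, $p\in\mathbb{R}[x]$. The truncated Hermite polynomials $P_n(x;z)$, $n\ge0$, are the monic polynomials in $x$ with $\deg P_n=n$ and $L[P_kP_n]=h_n(z)\delta_{k,n}$, where $h_n(z)=L[P_n^2]>0$. They satisfy the three-term recurrence $xP_n(x;z)=P_{n+1}(x;z)+\gamma_n(z)P_{n-1}(x;z)$ with $P_{-1}=0$, $P_0=1$, where $\gamma_n(z)=h_n(z)/h_{n-1}(z)$ for $n\ge1$. *)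

(* Defs.v *)
From HB Require Import structures.
From mathcomp Require Import all_boot all_order all_algebra.
From mathcomp Require Import all_classical all_reals all_analysis.
Set Implicit Arguments.
Unset Strict Implicit.
Unset Printing Implicit Defensive.
Import Order.TTheory GRing.Theory Num.Theory.
Import numFieldNormedType.Exports.
Local Open Scope classical_set_scope.
Local Open Scope ring_scope.

Definition truncL (R : realType) (z : R) (p : {poly R}) : R :=
  \int[@lebesgue_measure R]_(x in `[- z, z]) (p.[x] * expR (- x ^+ 2)).

(* In [P n z], n is the degree and z the truncation parameter; the polynomial
   variable is the x of P_n(x; z). *)
Definition sqnorm (R : realType) (P : nat -> R -> {poly R}) (n : nat) (z : R)
  : R := truncL z (P n z ^+ 2).

(* For each z > 0 these conditions determine every [P n z]. Positivity of
   [sqnorm P n z] is not assumed, as it follows from [P n z] being monic. *)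
Definition truncated_hermite (R : realType) (P : nat -> R -> {poly R}) : Prop :=
  forall z : R, 0 < z ->
    (forall n : nat, P n z \is monic /\ size (P n z) = n.+1) /\
    (forall k n : nat,
       truncL z (P k z * P n z) = if k == n then sqnorm P n z else 0).

(* Only meaningful for n >= 1. *)
Definition gamma (R : realType) (P : nat -> R -> {poly R}) (n : nat) (z : R)
  : R := sqnorm P n z / sqnorm P n.-1 z.

(* Main.v *)
(* Write p_n = P_n(z;z), E = exp(-z^2) and R_n = 2 E p_n^2 / h_n.
   - Since P_n(x;t) and P_n(x;z) are monic of the same degree,
     h_n(t) - h_n(z) = (L_t - L_z)[P_n(x;t) P_n(x;z)], whence h_n' = h_n R_n and
     gamma_n' = gamma_n (R_n - R_(n-1)).
   - Integrating (P_n P_(n-1) exp(-x^2))' over [-z, z] gives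
     n - 2 gamma_n = 2 E p_n p_(n-1) / h_(n-1), and so
     (n - 2 gamma_n)^2 = gamma_n R_n R_(n-1).
   - Integrating (x P_n^2 exp(-x^2))' gives
     z R_n = 2 n + 1 - 2 gamma_(n+1) - 2 gamma_n.
   Differentiating the last relation at n and n - 1, and eliminating gamma_(n+1)
   and gamma_(n-1) (possible because p_n <> 0), one gets
     z (gamma_n'' + 2 (6 gamma_n - n) (2 gamma_n - n))
       = - 2 (z^2 + 2 gamma_n - n) gamma_n (R_n + R_(n-1)),
   while gamma_n'^2 + 4 gamma_n (2 gamma_n - n)^2
       = gamma_n^2 (R_n + R_(n-1))^2. *)

Require Import Defs.
From HB Require Import structures.
From mathcomp Require Import all_boot all_order all_algebra.
From mathcomp Require Import all_classical all_reals all_analysis.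
From mathcomp Require Import ring lra.
Set Implicit Arguments.
Unset Strict Implicit.
Unset Printing Implicit Defensive.
Import Order.TTheory GRing.Theory Num.Theory.
Import numFieldNormedType.Exports.
Local Open Scope classical_set_scope.
Local Open Scope ring_scope.

(** * Preliminaries: continuity of finite sums and the reflection x -> -x of polynomials *)

Lemma continuous_at_sum (R : realType) (I : Type) (r : seq I) (f : I -> R -> R)
    (x : R) : (forall i, {for x, continuous (f i)}) ->
  {for x, continuous (fun y => \sum_(i <- r) f i y)}.
Proof.
move=> cf; apply: cvg_big; first exact: add_continuous.
by move=> i _; exact: cf.
Qed.


Lemma comp_oppXK (R : comNzRingType) :
  involutive (fun q : {poly R} => q \Po - 'X).
Proof.
move=> q; rewrite /= -comp_polyA -scaleN1r comp_polyZ comp_polyX scalerA.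
by rewrite mulrNN mulr1 scale1r comp_polyXr.
Qed.

Lemma size_comp_oppX (R : idomainType) (q : {poly R}) :
  size (q \Po - 'X) = size q.
Proof. by rewrite size_comp_poly2// size_polyN size_polyX. Qed.

(** * The functional L *)

Section TruncatedFunctional.
Variable R : realType.
Implicit Types (p q : {poly R}) (x z t : R) (F : R -> R).

Definition gaussw p x : R := p.[x] * expR (- x ^+ 2).

Lemma is_derive_gaussw p x :
  is_derive x 1 (gaussw p) (gaussw (p^`() - ('X * p) *+ 2) x).
Proof.
have dsq : is_derive x 1 (fun y : R => - y ^+ 2) (- (2 * x)).
  apply: is_derive_eq (is_deriveN (is_deriveX 2 (is_derive_id x 1))) _.
  by rewrite /GRing.scale/= expr1 mulr1.
have dE := @is_derive1_comp R expR _ x _ _ (is_derive_expR _) dsq.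
have dM := @is_deriveM R R (horner p) _ x 1 _ _ (is_derive_poly p x) dE.
apply: (is_derive_eq dM).
rewrite /gaussw !hornerE /GRing.scale/=.
by ring.
Qed.

Lemma continuous_gaussw p : continuous (gaussw p).
Proof.
move=> x; apply: differentiable_continuous; apply/derivable1_diffP.
by have [] := is_derive_gaussw p x.
Qed.

Lemma within_continuous_gaussw p (A : set R) :
  {within A, continuous (gaussw p)}.
Proof. by apply: continuous_subspaceT; exact: continuous_gaussw. Qed.

(** Linearity, symmetry, positivity and the derivative in [z] of [truncL] are all read off from such
    antiderivatives. *)
Lemma gaussw_antiderivative p (A : R) :
  exists F, forall x, `|x| <= A -> is_derive x 1 F (gaussw p x).
Proof.
(* The margin 1 makes the points with [|x| = A] interior, so that [F] has a two-sided derivative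
   there as well. *)
pose B := A + 1.
exists (fun x => \int[@lebesgue_measure R]_(t in `[- B, x]) gaussw p t) => x xA.
have : `|x| < B by rewrite (le_lt_trans xA)// ltrDl.
rewrite ltr_norml => /andP[Bx xB].
have intf : (@lebesgue_measure R).-integrable `[- B, B] (EFin \o gaussw p).
  apply: continuous_compact_integrable; first exact: segment_compact.
  exact: within_continuous_gaussw.
have [dF F'] := @continuous_FTC1_closed R (gaussw p) (- B) x B xB intf Bx
  (@continuous_gaussw p x).
by apply: DeriveDef; [exact: dF|rewrite -derive1E; exact: F'].
Qed.

Lemma truncL_antiderivative p z F : 0 < z ->
  (forall x, `|x| <= z -> is_derive x 1 F (gaussw p x)) ->
  truncL z p = F z - F (- z).
Proof.
move=> z0 dF.
have zz : - z < z by rewrite gtrN.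
have cF x : `|x| <= z -> {for x, continuous F}.
  by move=> /dF[dFx _]; apply: differentiable_continuous; apply/derivable1_diffP.
rewrite /truncL /Rintegral.
have := @continuous_FTC2 R (gaussw p) F (- z) z zz
  (@within_continuous_gaussw p _).
rewrite /gaussw => -> //.
- split.
  + move=> x; rewrite in_itv/= => /andP[x1 x2].
    by have [] : is_derive x 1 F (gaussw p x) by apply: dF; rewrite ler_norml !ltW.
  + by apply: cvg_at_right_filter; apply: cF; rewrite normrN gtr0_norm.
  + by apply: cvg_at_left_filter; apply: cF; rewrite gtr0_norm.
- move=> x; rewrite in_itv/= => /andP[x1 x2].
  rewrite derive1E; apply: derive_val.
  by apply: dF; rewrite ler_norml !ltW.
Qed.

Lemma truncL_parts p z : 0 < z ->
  truncL z (p^`() - ('X * p) *+ 2) = expR (- z ^+ 2) * (p.[z] - p.[- z]).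
Proof.
move=> z0.
rewrite (truncL_antiderivative z0 (fun x _ => is_derive_gaussw p x)).
by rewrite /gaussw sqrrN; ring.
Qed.

Lemma truncL_is_derive p z : 0 < z ->
  is_derive z 1 (fun t => truncL t p) (expR (- z ^+ 2) * (p.[z] + p.[- z])).
Proof.
(* Working up to [z + 1] gives a single antiderivative that serves all [t] near [z]. *)
move=> z0; have [F dF] := gaussw_antiderivative p (z + 1).
have z1 : `|z| <= z + 1 by rewrite gtr0_norm// lerDl.
have dFz := dF _ z1.
have dFNz : is_derive (- z) 1 F (gaussw p (- z)) by apply: dF; rewrite normrN.
have dB : is_derive z 1 (fun t => F t - F (- t))
    (expR (- z ^+ 2) * (p.[z] + p.[- z])).
  have dN := @is_derive1_comp R F _ z _ _ dFNz (is_deriveNid _ _).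
  apply: (is_derive_eq (is_deriveB dFz dN)).
  by rewrite /gaussw sqrrN; ring.
apply: near_eq_is_derive dB; near=> t.
have t0 : 0 < t by near: t; exact: lt_nbhsr.
have tz : t < z + 1 by near: t; apply: lt_nbhsl; rewrite ltrDl.
by apply/esym/(truncL_antiderivative t0) => x xt; apply/dF/(le_trans xt)/ltW.
Unshelve. all: by end_near. Qed.

Lemma truncLD p q z : 0 < z -> truncL z (p + q) = truncL z p + truncL z q.
Proof.
move=> z0.
have [F dF] := gaussw_antiderivative p z.
have [G dG] := gaussw_antiderivative q z.
rewrite (truncL_antiderivative z0 dF).
rewrite (truncL_antiderivative z0 dG).
rewrite [LHS](_ : _ = (F + G) z - (F + G) (- z)); first by rewrite !fctE; ring.
apply: truncL_antiderivative => //.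
move=> x x1; apply: (is_derive_eq (is_deriveD (dF _ x1) (dG _ x1))).
by rewrite /gaussw hornerD mulrDl.
Qed.

Lemma truncLZ (c : R) p z : 0 < z -> truncL z (c *: p) = c * truncL z p.
Proof.
move=> z0.
have [F dF] := gaussw_antiderivative p z.
rewrite (truncL_antiderivative z0 dF).
rewrite [LHS](_ : _ = (c \*: F) z - (c \*: F) (- z)).
  by rewrite /= /GRing.scale/=; ring.
apply: truncL_antiderivative => //.
move=> x x1; apply: (is_derive_eq (is_deriveZ c (dF _ x1))).
by rewrite /gaussw hornerZ /GRing.scale/= mulrA.
Qed.

Lemma truncL0 z : 0 < z -> truncL z 0 = 0.
Proof. by move=> z0; rewrite -(scale0r 0) truncLZ// mul0r. Qed.

Lemma truncLB p q z : 0 < z -> truncL z (p - q) = truncL z p - truncL z q.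
Proof. by move=> z0; rewrite truncLD// -scaleN1r truncLZ// mulN1r. Qed.

Lemma truncL_comp_opp p z : 0 < z -> truncL z (p \Po - 'X) = truncL z p.
Proof.
move=> z0; have [F dF] := gaussw_antiderivative p z.
rewrite (truncL_antiderivative z0 dF).
rewrite [RHS](_ : _ = (- (F \o -%R)) z - (- (F \o -%R)) (- z)); last first.
  have E x : (- (F \o -%R)) x = - F (- x) by [].
  by rewrite !E !opprK addrC.
apply: truncL_antiderivative => // x; rewrite -normrN => /dF dFx.
apply: is_derive_eq
  (is_deriveN (@is_derive1_comp R F _ x _ _ dFx (is_deriveNid _ _))) _.
by rewrite /gaussw horner_comp !hornerE sqrrN; ring.
Qed.
(** An antiderivative is nondecreasing; equal values at both ends would make it constant, and [p]
    would vanish on the whole open interval. *)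
Lemma truncL_gt0 p z : 0 < z -> p != 0 ->
  (forall x, -z < x < z -> 0 <= p.[x]) -> 0 < truncL z p.
Proof.
move=> z0 p0 pge0.
have [F dF] := gaussw_antiderivative p z.
rewrite (truncL_antiderivative z0 dF).
have dF' x : - z < x < z -> is_derive x 1 F (gaussw p x).
  by move=> xz; apply: dF; rewrite ltW// ltr_norml.
have cF : {within `[- z, z], continuous F}.
  apply: derivable_within_continuous => x; rewrite in_itv/= -ler_norml.
  by move=> /dF[].
have homF : {in `[- z, z] &, {homo F : x y / x <= y}}.
  apply: ger0_derive1_le_cc => // x; rewrite in_itv/= => xz.
    by have [] := dF' _ xz.
  rewrite derive1E (@derive_val _ _ _ _ _ _ _ (dF' _ xz)).
  by rewrite mulr_ge0 ?expR_ge0 ?pge0.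
have zz : - z <= z by rewrite ltW// gtrN.
have zin : z \in `[- z, z] by rewrite in_itv/= zz lexx.
have Nzin : - z \in `[- z, z] by rewrite in_itv/= zz lexx.
rewrite subr_gt0 lt_neqAle homF// andbT; apply/eqP => FE.
have Fcst x : - z < x < z -> F x = F z.
  move=> /andP[x1 x2]; have xin : x \in `[- z, z] by rewrite in_itv/= !ltW.
  apply/eqP; rewrite eq_le; apply/andP; split; first exact: homF (ltW x2).
  by rewrite -FE; apply: homF => //; exact: ltW.
have root0 x : - z < x < z -> p.[x] = 0.
  move=> xz; have [_ dFx] := dF' _ xz.
  have : 'D_1 F x = 0.
    rewrite (_ : 0 = 'D_1 (cst (F z)) x); last by rewrite derive_cst.
    apply: near_eq_derive; near=> y => /=; apply: Fcst; near: y.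
    by apply: near_in_itvoo; rewrite in_itv/=.
  rewrite dFx => /eqP; rewrite mulf_eq0 expR_eq0 orbF => /eqP//.
(* The points z/2, z/3, ... are [size p] distinct roots, one more than the degree allows. *)
pose s := [seq z / (i.+2)%:R | i <- iota 0 (size p)].
have us : uniq s.
  rewrite map_inj_uniq ?iota_uniq// => i j /(mulfI (lt0r_neq0 z0))/invr_inj.
  by move/eqP; rewrite eqr_nat => /eqP[].
have rs : all (root p) s.
  apply/allP => _ /mapP[i _ ->]; apply/eqP/root0; apply/andP; split.
    by rewrite (@lt_trans _ _ 0)// ?oppr_lt0// divr_gt0.
  by rewrite ltr_pdivrMr// ltr_pMr// ltr1n.
by have := max_poly_roots p0 rs us; rewrite size_map size_iota ltnn.
Unshelve. all: by end_near. Qed.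

Lemma truncL_coef (t : R) (p : {poly R}) N : 0 < t -> (size p <= N)%N ->
  truncL t p = \sum_(k < N) p`_k * truncL t 'X^k.
Proof.
move=> t0 sp.
have {1}-> : p = \sum_(k < N) p`_k *: 'X^k.
  rewrite -poly_def; apply/polyP => k; rewrite coef_poly.
  by case: ltnP => // kN; rewrite nth_default// (leq_trans sp).
rewrite (big_morph _ (fun p q => truncLD p q t0) (truncL0 t0)).
by apply: eq_bigr => k _; rewrite truncLZ.
Qed.

(* Continuity in t of the coefficients of the moving polynomial suffices: only
   the functional is differentiated. *)
Lemma truncL_secant (c : R -> {poly R}) N (z : R) : 0 < z ->
  (forall t, 0 < t -> (size (c t) <= N)%N) ->
  (forall k, {for z, continuous (fun t => (c t)`_k)}) ->
  exists G : R -> R, [/\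
    forall t, 0 < t -> truncL t (c t) - truncL z (c t) = G t * (t - z),
    {for z, continuous G} &
    G z = expR (- z ^+ 2) * ((c z).[z] + (c z).[- z])].
Proof.
move=> z0 sc cc.
(* [d k] is the Caratheodory slope at [z] of the [k]-th moment; [G] combines these slopes with the
   coefficients of [c t]. *)
have [d dP] := choice (fun k => (is_derive1_caratheodory _ _ _).1
  (truncL_is_derive 'X^k z0)).
exists (fun t => \sum_(k < N) (c t)`_k * d k t); split.
- move=> t t0; rewrite !(truncL_coef _ (sc _ t0))// -sumrB mulr_suml.
  by apply: eq_bigr => k _; rewrite -mulrBr; have [-> _ _] := dP k; rewrite mulrA.
- apply: continuous_at_sum => k; apply: continuousM; first exact: cc.
  by have [] := dP k.
- rewrite !(horner_coef_wide _ (sc _ z0)) -big_split mulr_sumr.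
  apply: eq_bigr => k _; have [_ _ ->] := dP k.
  by rewrite !hornerXn /=; ring.
Qed.

End TruncatedFunctional.

(** * Orthogonal polynomials for a fixed truncation parameter *)

(* The value 0 at index 0, which [gamma] does not have, makes the three-term
   recurrence and its consequences uniform in n. *)
Definition reccoef (R : realType) (P : nat -> R -> {poly R}) (n : nat)
    (z : R) : R :=
  if n is m.+1 then sqnorm P n z / sqnorm P m z else 0.

Section OrthogonalPolynomials.
Variables (R : realType) (P : nat -> R -> {poly R}) (z : R).
Hypotheses (HP : truncated_hermite P) (z0 : 0 < z).
Implicit Types (n k : nat) (q d : {poly R}).

Lemma P_monic n : P n z \is monic.
Proof. by have [/(_ n)[]] := HP z0. Qed.

Lemma P_size n : size (P n z) = n.+1.
Proof. by have [/(_ n)[]] := HP z0. Qed.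

Lemma P_coef n : (P n z)`_n = 1.
Proof.
by have /monicP := P_monic n; rewrite lead_coefE P_size.
Qed.

Lemma P_orth k n : k != n -> truncL z (P k z * P n z) = 0.
Proof. by have [_ ->] := HP z0; move=> /negbTE ->. Qed.

Lemma sub_lead_size n q : (size q <= n.+1)%N ->
  (size (q - q`_n *: P n z)%R <= n)%N.
Proof.
move=> sq; apply/leq_sizeP => j; rewrite leq_eqVlt => /predU1P[<-|nj].
  by rewrite coefB coefZ P_coef mulr1 subrr.
rewrite coefB coefZ [q`_j]nth_default; last exact: leq_trans sq nj.
by rewrite [_`_j]nth_default ?P_size// mulr0 subrr.
Qed.

Lemma truncL_low n q : (size q <= n)%N -> truncL z (P n z * q) = 0.
Proof.
(* With [n] fixed and the bound [m] varying, each induction step removes the top coefficient of [q]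
   along [P m z]. *)
suff: forall m, (m <= n)%N -> forall q, (size q <= m)%N ->
    truncL z (P n z * q) = 0.
  by apply.
elim=> [|m IH] mn {}q sq.
  by move: sq; rewrite leqn0 size_poly_eq0 => /eqP->; rewrite mulr0 truncL0.
rewrite -(subrK (q`_m *: P m z) q) mulrDr truncLD// IH ?sub_lead_size//; last exact: ltnW.
by rewrite -scalerAr truncLZ// P_orth ?mulr0 ?addr0// gtn_eqF.
Qed.

Lemma truncL_lead n q : (size q <= n.+1)%N ->
  truncL z (P n z * q) = q`_n * sqnorm P n z.
Proof.
move=> sq; rewrite -[in LHS](subrK (q`_n *: P n z) q) mulrDr truncLD//.
by rewrite truncL_low ?sub_lead_size// add0r -scalerAr truncLZ.
Qed.

Lemma truncL_sqr_gt0 q : q != 0 -> 0 < truncL z (q ^+ 2).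
Proof.
move=> q0; apply: truncL_gt0 => //; first by rewrite expf_neq0.
by move=> x _; rewrite horner_exp sqr_ge0.
Qed.

(** Test against [d] itself and use positivity. This uniqueness principle yields both the parity and
    the three-term recurrence. *)
Lemma orthogonal_eq0 n d : (size d <= n)%N ->
  (forall q, (size q <= n)%N -> truncL z (d * q) = 0) -> d = 0.
Proof.
move=> sd dq; apply/eqP; apply: contraT => /truncL_sqr_gt0.
by rewrite expr2 dq// ltxx.
Qed.

Lemma P_neq0 n : P n z != 0.
Proof. by rewrite monic_neq0// P_monic. Qed.

Lemma sqnorm_gt0 n : 0 < sqnorm P n z.
Proof. exact: truncL_sqr_gt0 (P_neq0 n). Qed.

Lemma lead_comp_oppX n : (P n z \Po - 'X)`_n = (-1) ^+ n.
Proof.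
have := @lead_coef_comp R (P n z) (- 'X).
rewrite size_polyN size_polyX => /(_ isT).
rewrite /lead_coef size_comp_oppX !P_size size_polyN size_polyX/=.
by rewrite P_coef coefN coefX mul1r.
Qed.

(** The weight is even, so P_n(-x) is also orthogonal to all lower degrees; once leading
    coefficients agree, the difference has lower degree and must vanish. *)
Lemma P_parity n : P n z \Po - 'X = (-1) ^+ n *: P n z.
Proof.
apply/eqP; rewrite -subr_eq0; apply/eqP; apply: (@orthogonal_eq0 n).
  by rewrite -lead_comp_oppX sub_lead_size// size_comp_oppX P_size.
move=> q sq; rewrite mulrBl -scalerAl truncLB// truncLZ// truncL_low// mulr0 subr0.
rewrite -truncL_comp_opp// comp_polyM comp_oppXK truncL_low//.
by rewrite size_comp_oppX.
Qed.

Lemma P_opp n : (P n z).[- z] = (-1) ^+ n * (P n z).[z].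
Proof.
by have := congr1 (horner ^~ z) (P_parity n); rewrite horner_comp !hornerE.
Qed.

(** By parity the integrand is odd; this is why the recurrence has no term in [P n z]. *)
Lemma truncL_X_sqr n : truncL z ('X * P n z ^+ 2) = 0.
Proof.
have := @truncL_comp_opp _ ('X * P n z ^+ 2) z z0.
rewrite comp_polyM comp_polyX rmorphXn/= P_parity exprZn sqrr_sign scale1r.
by rewrite mulNr -scaleN1r truncLZ// => H; lra.
Qed.

Lemma three_term_recurrence n : 'X * P n z =
  P n.+1 z + reccoef P n z *: P n.-1 z.
Proof.
apply/eqP; rewrite -subr_eq0; apply/eqP; apply: (@orthogonal_eq0 n.+1).
  apply/leq_sizeP => j nj; rewrite coefB coefD coefZ coefXM.
  case: j nj => // j; rewrite ltnS leq_eqVlt => /predU1P[<-|nj] /=.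
    rewrite !P_coef; case: (n) => [|m]; first by rewrite /= mul0r addr0 subrr.
    by rewrite /= [(P m z)`__]nth_default ?P_size// mulr0 addr0 subrr.
  have nj' : (n.-1 <= j)%N by exact: leq_trans (leq_pred n) (ltnW nj).
  rewrite [(P n z)`_j]nth_default ?P_size// [(P n.+1 z)`__]nth_default ?P_size//.
  by rewrite [(P n.-1 z)`__]nth_default ?P_size// mulr0 addr0 subrr.
(* Moving ['X] onto [q] leaves h_n times the coefficient of index n-1 of [q], which is what gamma_n
   h_(n-1) contributes on the other side. *)
have low q : (size q <= n)%N ->
    truncL z (('X * P n z - (P n.+1 z + reccoef P n z *: P n.-1 z)) * q) = 0.
  move=> sq; rewrite mulrBl mulrDl -scalerAl.
  rewrite truncLB// truncLD// truncLZ// (@truncL_low n.+1) ?add0r; last exact: leqW.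
  rewrite (_ : 'X * P n z * q = P n z * ('X * q)); last by ring.
  rewrite truncL_lead; last first.
    by rewrite (leq_trans (size_polyMleq _ _))// size_polyX.
  case: n sq => [|m] sq.
    by move: sq; rewrite leqn0 size_poly_eq0 => /eqP->; rewrite coefXM !mul0r subr0.
  rewrite truncL_lead//= coefXM/= mulrCA mulfVK ?gt_eqF ?sqnorm_gt0 ?subrr//.
(* The only test direction left is [P n z] itself, where every term vanishes. *)
move=> q sq; rewrite -(subrK (q`_n *: P n z) q) mulrDr truncLD// low ?sub_lead_size//.
rewrite add0r -scalerAr truncLZ// mulrBl mulrDl -scalerAl -mulrA -expr2.
rewrite truncLB// truncLD// truncLZ// truncL_X_sqr P_orth ?gtn_eqF// !add0r.
case: (n) => [|m]; first by rewrite /= !(mul0r,oppr0,mulr0).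
by rewrite /= [truncL z (P m z * _)]P_orth ?ltn_eqF// !(mul0r,oppr0,mulr0).
Qed.

Lemma coef_deriv_lead n : ((P n z)^`())`_n.-1 = n%:R.
Proof.
case: n => [|n]; last by rewrite coef_deriv P_coef.
by rewrite coef_deriv nth_default ?P_size// mul0rn.
Qed.

Lemma size_deriv_P n : (size (P n z)^`() <= n)%N.
Proof. by have := lt_size_deriv (P_neq0 n); rewrite P_size. Qed.

(** The derivative of P_n drops out by orthogonality to P_(n+1), and the boundary terms at z and -z
    add up because the product is odd. *)
Lemma sqnorm_recurrence_succ n : n.+1%:R * sqnorm P n z - 2 * sqnorm P n.+1 z =
  2 * expR (- z ^+ 2) * (P n.+1 z).[z] * (P n z).[z].
Proof.
have := truncL_parts (P n.+1 z * P n z) z0.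
rewrite (_ : _ - _ = P n z * (P n.+1 z)^`() + P n.+1 z * (P n z)^`()
    + (-2) *: (P n.+1 z * ('X * P n z))); last first.
  by rewrite derivM scaleNr scaler_nat; ring.
rewrite 2?truncLD// truncLZ// [truncL _ (P n z * _)]truncL_lead ?size_deriv_P//.
rewrite (coef_deriv_lead n.+1) truncL_low ?leqW ?size_deriv_P//.
rewrite truncL_lead; last first.
  by rewrite (leq_trans (size_polyMleq _ _))// size_polyX P_size.
rewrite coefXM/= P_coef !hornerM !P_opp => H.
transitivity (n.+1%:R * sqnorm P n z + 0 + -2 * (1 * sqnorm P n.+1 z)); first by ring.
rewrite H [(-1) ^+ n.+1]exprS; move: (sqrr_sign R n); move: (_ ^+ n) => s s1.
by ring: s1.
Qed.

(** Square the three-term recurrence: the cross term vanishes by orthogonality, and gamma_n^2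
    h_(n-1) = gamma_n h_n. *)
Lemma truncL_sqr_X n : truncL z (('X * P n z) ^+ 2) =
  sqnorm P n.+1 z + reccoef P n z * sqnorm P n z.
Proof.
rewrite three_term_recurrence; case: n => [|n]; first by rewrite /= scale0r mul0r !addr0.
rewrite (_ : _ ^+ 2 = P n.+2 z ^+ 2 + (2 * reccoef P n.+1 z) *: (P n.+2 z * P n z)
    + reccoef P n.+1 z ^+ 2 *: P n z ^+ 2); last first.
  by rewrite -!mul_polyC !rmorphM/= rmorph_nat /=; ring.
rewrite 2?truncLD// !truncLZ// P_orth ?gtn_eqF// mulr0 addr0 -!/(sqnorm P _ z).
by rewrite /= expr2 -mulrA divfK ?gt_eqF ?sqnorm_gt0.
Qed.

Lemma sqnorm_recurrence_X n :
  (2 * n%:R + 1) * sqnorm P n z - 2 * sqnorm P n.+1 z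
    - 2 * reccoef P n z * sqnorm P n z =
  2 * expR (- z ^+ 2) * z * (P n z).[z] ^+ 2.
Proof.
have := truncL_parts ('X * P n z ^+ 2) z0.
rewrite (_ : _ - _ = P n z ^+ 2 + 2%:R *: (P n z * ('X * (P n z)^`()))
    + (-2) *: ('X * P n z) ^+ 2); last first.
  by rewrite expr2 !derivM derivX scaleNr !scaler_nat; ring.
rewrite 2?truncLD// !truncLZ// truncL_sqr_X truncL_lead; last first.
  by rewrite (leq_trans (size_polyMleq _ _))// size_polyX ltnS size_deriv_P.
have -> : ('X * (P n z)^`())`_n = n%:R.
  by rewrite coefXM coef_deriv_lead; case: (n).
rewrite -/(sqnorm P n z) !hornerM !hornerX !P_opp => H.
transitivity (sqnorm P n z + 2 * (n%:R * sqnorm P n z) 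
    + -2 * (sqnorm P n.+1 z + reccoef P n z * sqnorm P n z)).
  by ring.
rewrite H; move: (sqrr_sign R n); move: (_ ^+ n) => s s1.
by ring: s1.
Qed.

(* If P_n = (x - z) q then L[P_n q] = 0, although (z - x) q^2 >= 0 on [-z, z]. *)
Lemma P_endpoint_neq0 n : (P n z).[z] != 0.
Proof.
apply/negP => /factor_theorem[q qE].
have q0 : q != 0 by apply: contraTneq (P_neq0 n) => q0; rewrite qE q0 mul0r eqxx.
have sq : size q = n.
  by have := P_size n; rewrite qE size_Mmonic ?monicXsubC// size_XsubC addn2/= => -[].
have : 0 < truncL z ((z%:P - 'X) * q ^+ 2).
  apply: truncL_gt0 => //.
    by rewrite mulf_neq0 ?expf_neq0// -opprB oppr_eq0 polyXsubC_eq0.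
  move=> x /andP[_ xz]; rewrite hornerM mulr_ge0 ?horner_exp ?sqr_ge0//.
  by rewrite !hornerE subr_ge0 ltW.
rewrite (_ : _ * _ = -1 *: (P n z * q)); last by rewrite qE scaleN1r; ring.
by rewrite truncLZ// truncL_low ?sq// mulr0 ltxx.
Qed.

End OrthogonalPolynomials.

(** * Dependence on the truncation parameter *)

Section Elimination.
Variable F : numFieldType.

(* G, Gp, Gm are gamma_n, gamma_(n+1), gamma_(n-1), and A, a, b, B are the
   logarithmic derivatives of h_(n+1), h_n, h_(n-1), h_(n-2). *)
Implicit Types z n G a b : F.

(** Multiplying by [a] turns the products with [A] and [b] into the squares of [sp] and [s0], and
    the linear relation removes [Gp]. What remains is a Riccati equation for [a] with coefficients
    in [z], [n], [G]. *)
Lemma logder_succ_elim z n G Gp a b A a' : a != 0 ->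
  (n - 2 * G) ^+ 2 = G * a * b -> (n + 1 - 2 * Gp) ^+ 2 = Gp * A * a ->
  z * a = 2 * n + 1 - 2 * Gp - 2 * G ->
  z * a' = - 2 * (Gp * (A - a)) - 2 * (G * (a - b)) - a ->
  z * a' = 2 * (n - 2 * G) * a - 2 * z ^+ 2 * a + 4 * z * (n - 2 * G) - z * a ^+ 2.
Proof.
move=> a0 s0 sp ra ->; apply: (mulfI a0).
have {}ra : Gp = (2 * n + 1 - z * a - 2 * G) / 2 by rewrite ra; field.
transitivity (- 2 * (Gp * A * a) + 2 * (G * a * b) + (2 * Gp - 2 * G - 1) * a ^+ 2).
  by ring.
by rewrite -s0 -sp ra; field.
Qed.

(** The mirror image: multiplying by [b] removes [a] and [B], then [Gm]. *)
Lemma logder_pred_elim z n G Gm a b B b' : b != 0 ->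
  (n - 2 * G) ^+ 2 = G * a * b -> (n - 1 - 2 * Gm) ^+ 2 = Gm * b * B ->
  z * b = 2 * n - 1 - 2 * G - 2 * Gm ->
  z * b' = - 2 * (G * (a - b)) - 2 * (Gm * (b - B)) - b ->
  z * b' = 2 * z ^+ 2 * b - 2 * (n - 2 * G) * b + z * b ^+ 2 - 4 * z * (n - 2 * G).
Proof.
move=> b0 s0 sm rb ->; apply: (mulfI b0).
have {}rb : Gm = (2 * n - 1 - z * b - 2 * G) / 2 by rewrite rb; field.
transitivity (2 * (Gm * b * B) - 2 * (G * a * b) + (2 * G - 2 * Gm - 1) * b ^+ 2).
  by ring.
by rewrite -s0 -sm rb; field.
Qed.

(** Since G' = G (a - b), the first two summands on the left are G''. After inserting the Riccati
    equations, the two sides differ by a multiple of [s0]. *)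
Lemma second_derivative_elim z n G a b a' b' :
  (n - 2 * G) ^+ 2 = G * a * b ->
  z * a' = 2 * (n - 2 * G) * a - 2 * z ^+ 2 * a + 4 * z * (n - 2 * G) - z * a ^+ 2 ->
  z * b' = 2 * z ^+ 2 * b - 2 * (n - 2 * G) * b + z * b ^+ 2 - 4 * z * (n - 2 * G) ->
  z * (G * (a - b) ^+ 2 + G * (a' - b') + 2 * (6 * G - n) * (2 * G - n)) =
  - 2 * (z ^+ 2 + 2 * G - n) * (G * (a + b)).
Proof.
move=> s0 da db.
transitivity (z * (G * (a - b) ^+ 2) + G * (z * a' - z * b')
   + z * (2 * (6 * G - n) * (2 * G - n))); first by ring.
rewrite da db.
transitivity (- 2 * (z ^+ 2 + 2 * G - n) * (G * (a + b))
  + 2 * z * ((n - 2 * G) ^+ 2 - G * a * b)); first by ring.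
by rewrite s0 subrr mulr0 addr0.
Qed.

Lemma square_elim z n G a b g2 :
  (n - 2 * G) ^+ 2 = G * a * b ->
  z * g2 = - 2 * (z ^+ 2 + 2 * G - n) * (G * (a + b)) ->
  z ^+ 2 * g2 ^+ 2 = 4 * (z ^+ 2 + 2 * G - n) ^+ 2
    * ((G * (a - b)) ^+ 2 + 4 * G * (2 * G - n) ^+ 2).
Proof.
move=> s0 e; rewrite -exprMn e -[2 * G - n]opprB sqrrN s0.
by ring.
Qed.

End Elimination.

(** * Derivatives in z of the norms, the recurrence coefficients and the logarithmic derivatives *)

Section TruncationDerivatives.
Variables (R : realType) (P : nat -> R -> {poly R}).
Hypothesis HP : truncated_hermite P.
Implicit Types (n k : nat) (z t : R).

(** The logarithmic derivative of [sqnorm P n], as [is_derive_sqnorm] shows. *)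
Definition logder n z :=
  2 * expR (- z ^+ 2) * (P n z).[z] ^+ 2 / sqnorm P n z.

Lemma sqnorm_neq0 n z : 0 < z -> sqnorm P n z != 0.
Proof. by move=> z0; rewrite gt_eqF// sqnorm_gt0. Qed.

Lemma logder_neq0 n z : 0 < z -> logder n z != 0.
Proof.
move=> z0; have Pz := P_endpoint_neq0 HP z0 n.
rewrite /logder !mulf_neq0 ?invr_eq0 ?sqnorm_neq0 ?expf_neq0 ?pnatr_eq0//.
by rewrite expR_eq0.
Qed.

Lemma logder_reccoef n z : 0 < z ->
  z * logder n z = 2 * n%:R + 1 - 2 * reccoef P n.+1 z - 2 * reccoef P n z.
Proof.
move=> z0; apply: (mulIf (sqnorm_neq0 n z0)).
transitivity (2 * expR (- z ^+ 2) * z * (P n z).[z] ^+ 2).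
  by rewrite /logder; field; rewrite sqnorm_neq0.
by rewrite -(sqnorm_recurrence_X HP z0) /=; field; rewrite sqnorm_neq0.
Qed.

Lemma sqr_reccoef n z : 0 < z ->
  (n%:R - 2 * reccoef P n z) ^+ 2 = reccoef P n z * logder n z * logder n.-1 z.
Proof.
(* At index 0 both sides vanish because [reccoef] is 0 there. *)
move=> z0; case: n => [|n]; first by rewrite /= mulr0 subr0 expr2 !mul0r.
rewrite (_ : _ - _ =
    (n.+1%:R * sqnorm P n z - 2 * sqnorm P n.+1 z) / sqnorm P n z); last first.
  by rewrite /=; field; rewrite sqnorm_neq0.
rewrite (sqnorm_recurrence_succ HP z0) /logder /=.
by field; rewrite !sqnorm_neq0.
Qed.

Definition coef_cont n z := forall k, {for z, continuous (fun t => (P n t)`_k)}.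

Lemma is_derive_sqnorm n z : 0 < z -> coef_cont n z ->
  is_derive z 1 (sqnorm P n) (sqnorm P n z * logder n z).
Proof.
move=> z0 cn.
have [||G [hG cG Gz]] := @truncL_secant R (fun t => P n t * P n z) n.*2.+1 z z0.
- move=> t t0; rewrite (leq_trans (size_polyMleq _ _))// !P_size//.
  by rewrite addSn/= addnS addnn.
- move=> k.
  rewrite (_ : (fun t => _) =
      fun t => \sum_(j < k.+1) (P n t)`_j * (P n z)`_(k - j)).
    apply: continuous_at_sum => j; apply: continuousM; first exact: cn.
    exact: cst_continuous.
  by apply/funext => t; rewrite coefM.
have lead t : 0 < t -> truncL t (P n t * P n z) = sqnorm P n t.
  by move=> t0; rewrite (truncL_lead HP)// ?P_size// (P_coef HP)// mul1r.
have leadz t : 0 < t -> truncL z (P n t * P n z) = sqnorm P n z.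
  by move=> t0; rewrite mulrC (truncL_lead HP)// ?P_size// (P_coef HP)// mul1r.
(* The Caratheodory form of differentiability, with [G] as slope; by parity the two endpoint terms
   of [G z] coincide. *)
have dG : is_derive z 1 (fun t => sqnorm P n z + G t * (t - z))
    (sqnorm P n z * logder n z).
  apply/is_derive1_caratheodory; exists G; split => //.
    by move=> t; rewrite subrr mulr0 addr0 addrC addKr.
  rewrite Gz !hornerM (P_opp HP z0) /logder [RHS]mulrC divfK ?sqnorm_neq0//.
  move: (sqrr_sign R n); move: (_ ^+ n) => s s1.
  by ring: s1.
apply: near_eq_is_derive dG; near=> t.
have t0 : 0 < t by near: t; exact: lt_nbhsr.
by rewrite -hG// lead// leadz// addrC subrK.
Unshelve. all: by end_near. Qed.

Lemma continuous_sqnorm n z : 0 < z -> coef_cont n z ->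
  {for z, continuous (sqnorm P n)}.
Proof.
move=> z0 cn; apply: differentiable_continuous; apply/derivable1_diffP.
by have [] := is_derive_sqnorm z0 cn.
Qed.

(** Simultaneous induction: continuous coefficients up to degree n make the norms, hence gamma_n,
    continuous, and the three-term recurrence passes this on to degree n+1. *)
Lemma continuous_coef_P n z : 0 < z -> coef_cont n z.
Proof.
move=> z0.
(* The identities used hold only for positive parameters, which suffices near [z]. *)
have near_cont (f f' : R -> R) : (forall t, 0 < t -> f t = f' t) ->
    {for z, continuous f} -> {for z, continuous f'}.
  move=> ff' cf; rewrite /prop_for /continuous_at -(ff' _ z0).
  apply: cvg_trans cf; apply: near_eq_cvg; near=> t; apply: ff'.
  by near: t; exact: lt_nbhsr.
have step m : coef_cont m z -> coef_cont m.-1 z ->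
    {for z, continuous (reccoef P m)} -> coef_cont m.+1 z.
  move=> cm cm' cg k.
  apply: (near_cont (fun t => (if k is j.+1 then (P m t)`_j else 0)
      - reccoef P m t * (P m.-1 t)`_k)).
    move=> t t0; have := congr1 (coefp k) (three_term_recurrence HP t0 m).
    rewrite /= coefXM coefD coefZ => E; apply: (canLR (addrK _)).
    by rewrite -E; case: (k).
  apply: continuousB; last by apply: continuousM => //; exact: cm'.
  by case: (k) => [|j]; [exact: cst_continuous|exact: cm].
have c0 : coef_cont 0 z.
  move=> k; apply: (near_cont (fun t => (1 : {poly R})`_k)) => [t t0|].
    have /size1_polyC -> : (size (P 0 t) <= 1)%N by rewrite P_size.
    by rewrite (P_coef HP).
  exact: cst_continuous.
suff: coef_cont n z /\ coef_cont n.+1 z by case.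
elim: n => [|n [IH1 IH2]].
  by split=> //; apply: step => //; exact: cst_continuous.
split=> //; apply: step => //; apply: continuousM; first exact: continuous_sqnorm.
by apply: continuousV; [rewrite sqnorm_neq0|exact: continuous_sqnorm].
Unshelve. all: by end_near. Qed.

Lemma is_derive_reccoef n z : 0 < z ->
  is_derive z 1 (reccoef P n) (reccoef P n z * (logder n z - logder n.-1 z)).
Proof.
move=> z0; case: n => [|n]; first by rewrite mul0r; exact: is_derive_cst.
have d1 := is_derive_sqnorm z0 (continuous_coef_P (n := n.+1) z0).
have d0 := is_derive_sqnorm z0 (continuous_coef_P (n := n) z0).
apply: (is_derive_eq (is_deriveM d1 (is_deriveV (sqnorm_neq0 n z0) d0))).
by rewrite /GRing.scale/=; field; rewrite sqnorm_neq0.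
Qed.

(** Differentiates [logder_reccoef] solved for [logder] instead of the definition, so that the
    moving endpoint value of [P n z] is never differentiated. *)
Lemma is_derive_logder n z : 0 < z -> is_derive z 1 (logder n)
  ((- 2 * (reccoef P n.+1 z * (logder n.+1 z - logder n z))
    - 2 * (reccoef P n z * (logder n z - logder n.-1 z)) - logder n z) / z).
Proof.
move=> z0.
have d1 := is_derive_reccoef n.+1 z0.
have d0 := is_derive_reccoef n z0.
have dV := is_deriveV (lt0r_neq0 z0) (is_derive_id z 1).
have dN := is_deriveB (is_deriveB (is_derive_cst (2 * n%:R + 1 : R) z 1)
  (is_deriveZ 2 d1)) (is_deriveZ 2 d0).
have dM := is_deriveM dN dV.
apply: (@near_eq_is_derive _ _ _
  (fun t => (2 * n%:R + 1 - 2 * reccoef P n.+1 t - 2 * reccoef P n t) * t^-1)).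
  near=> t; have t0 : 0 < t by near: t; exact: lt_nbhsr.
  by rewrite -logder_reccoef// mulrC mulKf// gt_eqF.
apply: (is_derive_eq dM).
transitivity ((- 2 * (reccoef P n.+1 z * (logder n.+1 z - logder n z))
    - 2 * (reccoef P n z * (logder n z - logder n.-1 z))) / z
  - (2 * n%:R + 1 - 2 * reccoef P n.+1 z - 2 * reccoef P n z) / z ^+ 2).
  rewrite !fctE /cst /= /GRing.scale /=; field.
  by rewrite gt_eqF//= sqnorm_neq0.
by rewrite -logder_reccoef// /=; field; rewrite gt_eqF//= sqnorm_neq0.
Unshelve. all: by end_near. Qed.

End TruncationDerivatives.

Theorem theorem26 (R : realType) (P : nat -> R -> {poly R})
    (HP : truncated_hermite P) (n : nat) (hn : (1 <= n)%N) (z : R) (hz : 0 < z) :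
  [/\ derivable (gamma P n) z 1,
      derivable (derive1 (gamma P n)) z 1 &
      z ^+ 2 * (derive1n 2 (gamma P n) z
                + 2 * (6 * gamma P n z - n%:R) * (2 * gamma P n z - n%:R)) ^+ 2
      = 4 * (z ^+ 2 + 2 * gamma P n z - n%:R) ^+ 2
        * ((derive1 (gamma P n) z) ^+ 2
           + 4 * gamma P n z * (2 * gamma P n z - n%:R) ^+ 2)].
Proof.
(* From here on the index of the theorem is [n.+1], where [gamma] and [reccoef] agree. *)
case: n hn => // n _.
rewrite (_ : gamma P n.+1 = reccoef P n.+1) //.
have dg (t : R) : 0 < t -> is_derive t 1 (reccoef P n.+1)
    (reccoef P n.+1 t * (logder P n.+1 t - logder P n t)).
  by move=> t0; exact: is_derive_reccoef.
have g1 (t : R) : 0 < t -> derive1 (reccoef P n.+1) t =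
    reccoef P n.+1 t * (logder P n.+1 t - logder P n t).
  by move=> /dg ?; rewrite derive1E; exact: derive_val.
have da := is_derive_logder HP n.+1 hz.
have db := is_derive_logder HP n hz.
set a' := (X in is_derive _ _ _ X) in da.
set b' := (X in is_derive _ _ _ X) in db.
have d2 : is_derive z 1 (derive1 (reccoef P n.+1))
  (reccoef P n.+1 z * (logder P n.+1 z - logder P n z) ^+ 2
    + reccoef P n.+1 z * (a' - b')).
  apply: near_eq_is_derive
    (is_derive_eq (is_deriveM (dg z hz) (is_deriveB da db)) _).
    by near=> t; rewrite g1//; near: t; exact: lt_nbhsr.
  by rewrite !fctE /GRing.scale/=; ring.
split; [by have [] := dg z hz|by have [] := d2|].
rewrite derive1nS derive1n1 [derive1 (derive1 _) z]derive1E.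
rewrite (@derive_val _ _ _ _ _ _ _ d2) g1//.
have z0 := lt0r_neq0 hz.
have s0 := sqr_reccoef HP n.+1 hz.
apply: square_elim => //; apply: second_derivative_elim => //.
- apply: (logder_succ_elim (logder_neq0 HP n.+1 hz) s0
    (A := logder P n.+2 z) (Gp := reccoef P n.+2 z)).
  + by rewrite natr1 sqr_reccoef.
  + by rewrite logder_reccoef.
  + by rewrite /a' [z * _]mulrC divfK.
(* If [n] is 0 here, [Gm] is 0, so the truncated index [n.-1] in [B] is harmless. *)
- apply: (logder_pred_elim (logder_neq0 HP n hz) s0
    (B := logder P n.-1 z) (Gm := reccoef P n z)).
  + by rewrite -natr1 addrK sqr_reccoef.
  + by rewrite logder_reccoef// -natr1; ring.
  + by rewrite /b' [z * _]mulrC divfK.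
Unshelve. all: by end_near. Qed.
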